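(* Let $R$ be a finite non-commutative ring and let $N$ be an ideal of $R$. Then $\Pr(R)\le \Pr(R/N)\Pr(N)$. The equality holds if $N\cap[R,R]=\{0\}$.
   Context: Rings are associative and are not required to have an identity; an ideal is two-sided (and is itself regarded as a ring), and $R/N$ is the quotient ring. For a finite ring $T$, $\Pr(T)=\dfrac{|\{(s,t)\in T\times T: st=ts\}|}{|T|^2}$. $[R,R]$ denotes the subgroup of $(R,+)$ generated by all additive commutators $[s,r]=sr-rs$ with $s,r\in R$. *)

(* Defs.v *)
From HB Require Import structures.
From mathcomp Require Import all_boot all_order all_fingroup all_algebra.
From mathcomp Require Import generic_quotient.

Set Implicit Arguments.
Unset Strict Implicit.
Unset Printing Implicit Defensive.

Import GRing.Theory.
Local Open Scope ring_scope.
Local Open Scope quotient_scope.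

Reserved Notation "x ** y" (at level 40, left associativity).

(* MathComp's ring structures all carry a unit, hence this one.               *)
HB.mixin Record Zmodule_isRng R of GRing.Zmodule R := {
  rng_mul : R -> R -> R;
  rng_mulA : associative rng_mul;
  rng_mulDl : left_distributive rng_mul +%R;
  rng_mulDr : right_distributive rng_mul +%R
}.

#[short(type="rngType")]
HB.structure Definition Rng := {R of Zmodule_isRng R & GRing.Zmodule R}.

#[short(type="finRngType")]
HB.structure Definition FinRng := {R of Rng R & Finite R}.

Notation "x ** y" := (rng_mul x y) : ring_scope.

(* Two-sided ideals: additive subgroups absorbing products on both sides.     *)
HB.mixin Record isRngIdeal (R : rngType) (N : {pred R}) := {
  rng_ideal_mull : forall r x : R, x \in N -> r ** x \in N;
  rng_ideal_mulr : forall r x : R, x \in N -> x ** r \in N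
}.

#[short(type="rngIdeal")]
HB.structure Definition RngIdeal (R : rngType) :=
  {N of isRngIdeal R N & GRing.ZmodClosed R N}.

Section IdealAsRing.
Variables (R : rngType) (N : rngIdeal R).

Definition ideal_rng : Type := {x : R | x \in N}.

HB.instance Definition _ := [isSub of ideal_rng for @sval R _].
HB.instance Definition _ := [Choice of ideal_rng by <:].
HB.instance Definition _ := [SubChoice_isSubZmodule of ideal_rng by <:].

Definition ideal_mul (x y : ideal_rng) : ideal_rng :=
  exist _ (val x ** val y) (rng_ideal_mull (val x) (val y) (valP y)).

Fact ideal_mulA : associative ideal_mul.
Proof. by move=> x y z; apply: val_inj; rewrite /= rng_mulA. Qed.

Fact ideal_mulDl : left_distributive ideal_mul +%R.
Proof. by move=> x y z; apply: val_inj; rewrite /= rng_mulDl. Qed.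

Fact ideal_mulDr : right_distributive ideal_mul +%R.
Proof. by move=> x y z; apply: val_inj; rewrite /= rng_mulDr. Qed.

HB.instance Definition _ :=
  Zmodule_isRng.Build ideal_rng ideal_mulA ideal_mulDl ideal_mulDr.

End IdealAsRing.

HB.instance Definition _ (R : finRngType) (N : rngIdeal R) :=
  [Finite of ideal_rng N by <:].

Section RngQuotient.
Variables (R : rngType) (N : rngIdeal R).

(* {ideal_quot N} is the quotient of the additive group by x - y \in N.       *)
Definition rng_quot : Type := {ideal_quot N}.

HB.instance Definition _ := GRing.Zmodule.on rng_quot.
HB.instance Definition _ := EqQuotient.on rng_quot.

Definition quot_mul : rng_quot -> rng_quot -> rng_quot :=
  lift_op2 rng_quot (@rng_mul R).

Fact eq_quotP (x y : R) : reflect (x = y %[mod rng_quot]) (x - y \in N).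
Proof. by rewrite (Quotient.idealrBE N); apply: eqP. Qed.

Fact quot_piM (x y : R) :
  quot_mul (\pi_rng_quot x) (\pi_rng_quot y) = \pi_rng_quot (x ** y).
Proof.
have repr_sub (z : R) : repr (\pi_rng_quot z) - z \in N.
  by apply/eq_quotP; rewrite reprK.
have mulN0 a b c : a ** b - a ** c = a ** (b - c).
  by apply/eqP; rewrite subr_eq -rng_mulDr subrK.
have mul0N a b c : a ** c - b ** c = (a - b) ** c.
  by apply/eqP; rewrite subr_eq -rng_mulDl subrK.
unlock quot_mul; apply/eq_quotP.
rewrite -(subrKA (repr (\pi_rng_quot x) ** y)) mulN0 mul0N rpredD //.
  exact/rng_ideal_mull/repr_sub.
exact/rng_ideal_mulr/repr_sub.
Qed.

Fact quot_piD (x y : R) :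
  \pi_rng_quot x + \pi_rng_quot y = \pi_rng_quot (x + y).
Proof. exact: (esym (@pi_addr _ _ _ _ _ (Quotient.quot N) x y)). Qed.

Fact quot_mulA : associative quot_mul.
Proof.
by elim/quotW=> x; elim/quotW=> y; elim/quotW=> z; rewrite !quot_piM rng_mulA.
Qed.

Fact quot_mulDl : left_distributive quot_mul +%R.
Proof.
elim/quotW=> x; elim/quotW=> y; elim/quotW=> z.
by rewrite !(quot_piD, quot_piM) rng_mulDl.
Qed.

Fact quot_mulDr : right_distributive quot_mul +%R.
Proof.
elim/quotW=> x; elim/quotW=> y; elim/quotW=> z.
by rewrite !(quot_piD, quot_piM) rng_mulDr.
Qed.

HB.instance Definition _ :=
  Zmodule_isRng.Build rng_quot quot_mulA quot_mulDl quot_mulDr.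

End RngQuotient.

HB.instance Definition _ (R : finRngType) (N : rngIdeal R) :
  isCountable (rng_quot N) := CanIsCountable (@reprK R (rng_quot N)).
HB.instance Definition _ (R : finRngType) (N : rngIdeal R) :
  isFinite (rng_quot N) := CanIsFinite (@reprK R (rng_quot N)).

Definition Pr (T : finRngType) : rat :=
  #|[set p : T * T | p.1 ** p.2 == p.2 ** p.1]|%:R / (#|T| ^ 2)%:R.

Definition rng_comm (R : rngType) (s r : R) : R := s ** r - r ** s.

(* As for the ring structures of MathComp, the group law of a finRngType is   *)
(* +%R, so that <<_>> below generates an additive subgroup.                   *)
#[non_forgetful_inheritance]
HB.instance Definition _ (R : finRngType) := [finGroupMixin of R for +%R].

Definition comm_subgroup (R : finRngType) : {set R} :=
  <<[set rng_comm s r | s in R, r in R]>>%g.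

(* Main.v *)
Require Import Defs.
From mathcomp Require Import all_boot all_order all_fingroup all_algebra.
From mathcomp Require Import generic_quotient.

(** Write [C(A, B)] for the number of commuting pairs in [A x B].  The pairs
    of elements of [R] are sorted by their images in [R/N x R/N].  Only the
    pairs [(a, b)] of commuting cosets contribute, so the inequality follows
    from [C(a, b) <= C(N, N)] together with [#|R| = #|R/N| * #|N|].

    That bound is one translation argument used twice.  For a fixed [s], the
    elements of the coset [b] commuting with [s] differ from one another by
    elements of [N] commuting with [s]; subtracting one of them injects them
    into [N] ([card_cent_coset_le]).  Summing over [s] gives
    [C(a, b) <= C(a, N)]; since [C] is symmetric, a second use gives
    [C(a, N) = C(N, a) <= C(N, N)] ([ncomm_coset_le]).

    If [N] meets the commutator subgroup trivially, two elements commute as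
    soon as their commutator lies in [N].  Then all of [a x b] commutes whenever [a] and [b]
    do, and all of [N x N] commutes, so [C(a, b) = #|N| ^ 2 = C(N, N)] and
    every inequality above is an equality ([eq_ncomm_coset]). *)

Set Implicit Arguments.
Unset Strict Implicit.
Unset Printing Implicit Defensive.

Import Order.TTheory GRing.Theory Num.Theory.
Local Open Scope ring_scope.
Local Open Scope quotient_scope.

Section RngTheory.
Variable R : rngType.
Implicit Types x y z : R.

Lemma rng_mulBr x y z : x ** (y - z) = x ** y - x ** z.
Proof. by apply/eqP; rewrite eq_sym subr_eq -rng_mulDr subrK. Qed.

Lemma rng_mulBl x y z : (x - y) ** z = x ** z - y ** z.
Proof. by apply/eqP; rewrite eq_sym subr_eq -rng_mulDl subrK. Qed.

End RngTheory.

Section CommutingPairs.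
Variable R : finRngType.
Implicit Types (A B : {set R}) (s t : R).

Definition rng_cent B s : {set R} := [set t in B | s ** t == t ** s].

Definition comm_pairs A B : {set R * R} :=
  [set p in setX A B | p.1 ** p.2 == p.2 ** p.1].

Lemma card_comm_pairs A B :
  #|comm_pairs A B| = (\sum_(s in A) #|rng_cent B s|)%N.
Proof.
under [RHS]eq_bigr => s _ do rewrite -sum1_card.
rewrite -sum1_card pair_big_dep /=; apply: eq_bigl => -[s t].
by rewrite !inE /= andbA.
Qed.

Lemma card_comm_pairsC A B : #|comm_pairs A B| = #|comm_pairs B A|.
Proof.
have swapK : involutive (fun p : R * R => (p.2, p.1)) by case.
rewrite -(card_imset _ (inv_inj swapK)); apply: eq_card => -[t s].
rewrite (can_imset_pre _ swapK) !inE /= eq_sym.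
by rewrite [(s \in A) && _]andbC.
Qed.

Lemma leq_comm_pairs_r A B B' :
    (forall s, #|rng_cent B s| <= #|rng_cent B' s|)%N ->
  (#|comm_pairs A B| <= #|comm_pairs A B'|)%N.
Proof. by move=> leB; rewrite !card_comm_pairs; apply: leq_sum. Qed.

Lemma Pr_comm_pairs :
  Pr R = #|comm_pairs setT setT|%:R / (#|R| ^ 2)%:R.
Proof.
by congr (_%:R / _); apply: eq_card => p; rewrite !inE.
Qed.

End CommutingPairs.

Section Cosets.
Variables (R : finRngType) (N : rngIdeal R).
Implicit Types (a b : rng_quot N) (s t : R).

Definition ideal_set : {set R} := [set x | x \in N].
Definition coset_set b : {set R} := [set x | \pi_(rng_quot N) x == b].

Lemma coset_subr b s t :
  s \in coset_set b -> t \in coset_set b -> s - t \in N.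
Proof. by rewrite !inE => /eqP sb /eqP tb; apply/eq_quotP; rewrite sb tb. Qed.

Lemma card_coset b : #|coset_set b| = #|ideal_set|.
Proof.
rewrite -(card_imset _ (addIr (- repr b))); apply: eq_card => x.
rewrite (can_imset_pre _ (subrK (repr b))) !inE.
rewrite -{2}(reprK b) -[in RHS](addrK (repr b) x).
by apply/eqP/idP => /eq_quotP.
Qed.

Lemma card_ideal_rng : #|{: ideal_rng N}| = #|ideal_set|.
Proof. by rewrite card_sub cardsE. Qed.

Lemma card_rng_quot : #|R| = (#|{: rng_quot N}| * #|ideal_set|)%N.
Proof.
rewrite -[LHS]sum1_card (partition_big (\pi_(rng_quot N)) predT) //=.
rewrite -sum_nat_const; apply: eq_bigr => b _.
by rewrite sum1_card -(card_coset b) cardsE.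
Qed.

Lemma Pr_ideal :
  Pr (ideal_rng N)
    = #|comm_pairs ideal_set ideal_set|%:R / (#|ideal_set| ^ 2)%:R.
Proof.
rewrite /Pr card_ideal_rng; congr (_%:R / _).
pose f (p : ideal_rng N * ideal_rng N) := (val p.1, val p.2).
have f_inj : injective f.
  by move=> [x y] [x' y'] [/val_inj -> /val_inj ->].
rewrite -(card_imset _ f_inj); apply: eq_card => -[s t]; rewrite !inE /=.
apply/imsetP/idP => [[[x y]] | /andP[/andP[sN tN] st]].
  rewrite inE /= => /eqP/(congr1 val)/= xy [-> ->].
  by rewrite xy eqxx !(valP x, valP y).
exists (exist _ s sN, exist _ t tN) => //.
by rewrite inE -val_eqE.
Qed.

(** Two elements of the coset commuting with [s] differ by an element of the
    ideal commuting with [s], so translating by one of them injects the left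
    set into the right one. *)
Lemma card_cent_coset_le b s :
  (#|rng_cent (coset_set b) s| <= #|rng_cent ideal_set s|)%N.
Proof.
have [-> | [t0]] := set_0Vmem (rng_cent (coset_set b) s).
  by rewrite cards0.
rewrite inE => /andP[t0b /eqP st0].
rewrite -(card_imset _ (addIr (- t0))); apply/subset_leq_card/subsetP => x.
case/imsetP => t; rewrite inE => /andP[tb /eqP st] ->.
by rewrite !inE (coset_subr tb t0b) rng_mulBr rng_mulBl st st0 eqxx.
Qed.

Lemma ncomm_coset_le a b :
  (#|comm_pairs (coset_set a) (coset_set b)|
    <= #|comm_pairs ideal_set ideal_set|)%N.
Proof.
apply: leq_trans (leq_comm_pairs_r _ (card_cent_coset_le b)) _.
by rewrite card_comm_pairsC; apply/leq_comm_pairs_r/card_cent_coset_le.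
Qed.

Lemma pi_rng_mul s t :
  \pi_(rng_quot N) s ** \pi_(rng_quot N) t = \pi_(rng_quot N) (s ** t).
Proof. exact: quot_piM. Qed.

Lemma comm_pi s t :
  (\pi_(rng_quot N) s ** \pi_(rng_quot N) t
     == \pi_(rng_quot N) t ** \pi_(rng_quot N) s) = (rng_comm s t \in N).
Proof. by rewrite !pi_rng_mul; apply/eqP/idP => /eq_quotP. Qed.

Lemma ncomm_partition :
  #|comm_pairs [set: R] setT| =
  (\sum_(p in comm_pairs [set: rng_quot N] setT)
     #|comm_pairs (coset_set p.1) (coset_set p.2)|)%N.
Proof.
pose pi2 (p : R * R) := (\pi_(rng_quot N) p.1, \pi_(rng_quot N) p.2).
rewrite -sum1_card.
rewrite (partition_big pi2 (mem (comm_pairs [set: rng_quot N] setT))) /=.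
  apply: eq_bigr => -[a b] _; rewrite sum1_card; apply: eq_card => -[s t].
  by rewrite unfold_in !inE /= xpair_eqE andbC.
by move=> [s t]; rewrite !inE /= => /eqP st; rewrite !pi_rng_mul st.
Qed.

Section TrivialMeet.
Hypothesis trivN : ideal_set :&: comm_subgroup R = [set 0].

Lemma comm_of_ideal s t : rng_comm s t \in N -> s ** t = t ** s.
Proof.
move=> stN; apply/eqP; rewrite -subr_eq0 -in_set1 -trivN !inE stN.
exact/mem_gen/imset2_f.
Qed.

Lemma ncomm_ideal : #|comm_pairs ideal_set ideal_set| = (#|ideal_set| ^ 2)%N.
Proof.
rewrite -mulnn -cardsX; apply: eq_card => -[s t].
rewrite !inE /=; apply/andb_idr => /andP[sN tN].
by apply/eqP/comm_of_ideal; rewrite rpredB ?rng_ideal_mull.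
Qed.

Lemma ncomm_coset a b : a ** b = b ** a ->
  #|comm_pairs (coset_set a) (coset_set b)| = (#|ideal_set| ^ 2)%N.
Proof.
move=> ab; rewrite -mulnn -{1}(card_coset a) -(card_coset b) -cardsX.
apply: eq_card => -[s t]; rewrite !inE /=.
apply/andb_idr => /andP[/eqP sa /eqP tb].
by apply/eqP/comm_of_ideal; rewrite -comm_pi sa tb ab.
Qed.

Lemma eq_ncomm_coset a b : a ** b = b ** a ->
  #|comm_pairs (coset_set a) (coset_set b)|
    = #|comm_pairs ideal_set ideal_set|.
Proof. by move=> ab; rewrite ncomm_coset // ncomm_ideal. Qed.

End TrivialMeet.

Lemma Pr_quot_ideal :
  Pr (rng_quot N) * Pr (ideal_rng N)
    = (#|comm_pairs [set: rng_quot N] setT|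
         * #|comm_pairs ideal_set ideal_set|)%:R / (#|R| ^ 2)%:R.
Proof.
by rewrite Pr_comm_pairs Pr_ideal mulf_div -!natrM card_rng_quot expnMn.
Qed.

End Cosets.

Theorem corollary2p14 (R : finRngType)
    (hR : ~ commutative (@rng_mul R)) (N : rngIdeal R) :
  Pr R <= Pr (rng_quot N) * Pr (ideal_rng N) /\
  ([set x : R | x \in N] :&: comm_subgroup R = [set 0] ->
   Pr R = Pr (rng_quot N) * Pr (ideal_rng N)).
Proof.
rewrite Pr_quot_ideal Pr_comm_pairs (ncomm_partition N) -sum_nat_const; split.
  apply: ler_wpM2r; first by rewrite invr_ge0 ler0n.
  by rewrite ler_nat; apply: leq_sum => p _; apply: ncomm_coset_le.
move=> trivN; congr (_%:R / _); apply: eq_bigr => p.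
by rewrite !inE /= => /eqP /(eq_ncomm_coset trivN).
Qed.
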